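(* Let $\{X_n\}_{n=1}^\infty$ be nonnegative, bounded, i.i.d. random variables with $\mathbb E(\ln X_1)=0$ and $\mathbb E\big((\ln X_1^2)^2\big)=\sigma^2\in(0,\infty)$. Then for each $\alpha>0$, $$f(z)=\sum_{n=1}^\infty\frac1{n^\alpha}z^n\notin H_*.$$
   Context: For the i.i.d. sequence $\{X_n\}$ on a probability space $(\Omega,\mathcal F,\mathbb P)$ put $w_0=1$, $w_n=X_1\cdots X_n$ ($n\ge1$). For each $\omega$, the random Hardy space is $H^2_\mu(\omega)=\{f(z)=\sum_{n\ge0}a_nz^n:\ \sum_{n\ge0}|a_n|^2w_n(\omega)^2<\infty\}$, where $\mu$ is the law of $X_1$. $H_*$ is the set of $f(z)=\sum_{n\ge0}a_nz^n$ such that $f\in H^2_\mu$ almost surely. *)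

(* Defs.v *)
From HB Require Import structures.
From mathcomp Require Import all_boot all_order all_algebra finmap.
From mathcomp Require Import complex.
From mathcomp Require Import all_classical all_reals all_analysis.

Set Implicit Arguments.
Unset Strict Implicit.
Unset Printing Implicit Defensive.

Import Order.TTheory GRing.Theory Num.Theory.
Import numFieldNormedType.Exports.

Local Open Scope classical_set_scope.
Local Open Scope ring_scope.

(* Sequences of random variables are indexed from 0 : X k stands for X_(k+1). *)

Section RandomVariables.
Context {d : measure_display} {T : measurableType d} {R : realType}.
Variables (P : probability T R) (X : nat -> {RV P >-> R}).

Definition mutually_independent : Prop :=
  forall (J : {fset nat}) (B : nat -> set R),
    (forall i, measurable (B i)) ->
    P (\bigcap_(i in [set` J]) (X i @^-1` B i)) =
    (\prod_(i <- J) P (X i @^-1` B i))%E.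

Definition identically_distributed : Prop :=
  forall (m n : nat) (B : set R), measurable B ->
    distribution P (X m) B = distribution P (X n) B.

Definition iid : Prop := mutually_independent /\ identically_distributed.

End RandomVariables.

(* A power series \sum_(n >= 0) a_n z^n with complex coefficients, given by
   its sequence of coefficients. *)
Definition power_series (R : realType) : Type := nat -> R[i].

Section RandomHardySpace.
Context {d : measure_display} {T : measurableType d} {R : realType}.
Variables (P : probability T R) (X : nat -> {RV P >-> R}).

Definition weight (n : nat) (omega : T) : R := \prod_(k < n) X k omega.

Definition random_hardy (omega : T) : set (power_series R) :=
  [set a | (\sum_(0 <= n <oo)
              ((ComplexField.Normc.normc (a n)) ^+ 2 * (weight n omega) ^+ 2)%:E
            < +oo)%E].

Definition hardy_star : set (power_series R) :=
  [set a | {ae P, forall omega, random_hardy omega a}].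

End RandomHardySpace.

Definition zeta_series {R : realType} (alpha : R) : power_series R :=
  fun n => if n == 0%N then 0 else ((n%:R `^ alpha)^-1)%:C%C.

(* Main.v *)
Require Import Defs.
From HB Require Import structures.
From mathcomp Require Import all_boot all_order all_algebra finmap.
From mathcomp Require Import complex.
From mathcomp Require Import all_classical all_reals all_analysis.
From mathcomp Require Import measurable_realfun ring lra.

Import Order.TTheory GRing.Theory Num.Theory.
Import numFieldNormedType.Exports.
Import HBNNSimple.

Local Open Scope classical_set_scope.
Local Open Scope ring_scope.

(** Put S_n = ln w_n, a centred random walk with finite variance.  The coefficients
n^(-alpha) cost only alpha ln n on the logarithmic scale, whereas S_n is of order
sqrt n with a probability bounded away from 0.  Hence w_n >= n^alpha for infinitely
many n with positive probability, and on that event the terms n^(-2 alpha) w_n^2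
do not tend to 0.

The fluctuation S_n >= c sqrt n is obtained without a central limit theorem.
Since X_1 is bounded, the variable W = w_n^(1/sqrt n) = exp(S_n / sqrt n) has
moments of every positive order, and independence turns them into powers:
E W = (E X_1^t)^n and E W^2 = (E X_1^(2t))^n with t = 1/sqrt n.  For a centred
variable Y = ln X_1 bounded above, a second order expansion of the exponential
gives 1 + c t^2 <= E exp(tY) <= 1 + C t^2 for small t >= 0, with c > 0
([expR_moment_ge], [expR_moment_le]).  Therefore E W >= 1 + c while E W^2 remains
bounded, and a second moment inequality in the style of Paley and Zygmund
([prob_gt_of_second_moment]) bounds P(W > 1 + eps) below uniformly in n
([prob_root_weight_gt]).  On that event w_n > (1 + eps)^(sqrt n), which exceeds
n^alpha for large n ([powR_le_of_root]); the upper limit of these events has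
positive probability ([lim_sup_set_ge]).

The product formula for expectations ([integral_prod_indep]) is derived from
independence of events by replacing indicator functions with general functions
one factor at a time ([integral_indep_ext]). *)

(** * Elementary estimates *)

(** From exp(-u) >= 1 - u one gets exp u <= 1 / (1 - u), and the quadratic on the
right dominates this fraction for u <= 1/2. *)
Lemma expR_le_quad {R : realType} (u : R) : u <= 2^-1 ->
  expR u <= 1 + u + 2 * u ^+ 2.
Proof.
move=> u_le; have h := expR_ge1Dx (- u).
have e0 := expR_gt0 u; have := expRxMexpNx_1 u => e1.
have {}h : expR u * (1 - u) <= 1.
  by rewrite -[leRHS]e1; apply: ler_wpM2l => //; exact: ltW.
have u1 : 0 < 1 - u by lra.
rewrite -(ler_pM2r u1); apply: (le_trans h); nra.
Qed.

(** Squaring exp(u/2) >= 1 + u/2 gives the quadratic term where u >= 0; for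
negative u the tangent line suffices. *)
Lemma expR_ge_quad {R : realType} (u : R) :
  1 + u + Num.max u 0 ^+ 2 / 4 <= expR u.
Proof.
have [u0|u0] := leP u 0; first by rewrite expr0n /= mul0r addr0 expR_ge1Dx.
have := expR_ge1Dx (u / 2); have := expR_gt0 (u / 2).
have -> : expR u = expR (u / 2) ^+ 2.
  by rewrite expr2 -expRD -splitr.
nra.
Qed.

Lemma bernoulli_ineq {R : realDomainType} (x : R) n : 0 <= x ->
  1 + x *+ n <= (1 + x) ^+ n.
Proof.
move=> x0; elim: n => [|n IH]; first by rewrite mulr0n addr0 expr0.
have xn0 : 0 <= x *+ n by rewrite mulrn_wge0.
rewrite exprS mulrS; move: IH xn0; set u := x *+ n; set v := (1 + x) ^+ n.
by move=> IH u0; nra.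
Qed.

Lemma ln_le_sqrt {R : realType} (a c : R) : 0 <= a -> 0 < c ->
  exists N, forall n, (N <= n)%N -> a * ln n%:R <= Num.sqrt n%:R * c.
Proof.
move=> a0 c0; pose K := (4 * a / c) ^+ 4 + 1.
have K0 : 0 <= K by rewrite addr_ge0 // exprn_ge0 // divr_ge0 ?mulr_ge0 // ltW.
exists (Num.bound K) => n Nn.
have Kn : K <= n%:R.
  by apply: le_trans (ltW (archi_boundP K0)) _; rewrite ler_nat.
have n0 : 0 < n%:R :> R.
  by apply: lt_le_trans Kn; rewrite ltr_wpDl ?exprn_ge0 // divr_ge0 ?mulr_ge0 // ltW.
(* With r = n^(1/4) the claim reads 4 a ln r <= c r^2, and ln r <= r. *)
pose r : R := Num.sqrt (Num.sqrt n%:R).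
have r0 : 0 < r by rewrite !sqrtr_gt0.
have r2 : Num.sqrt n%:R = r ^+ 2 by rewrite sqr_sqrtr // sqrtr_ge0.
have r4 : n%:R = r ^+ 4 :> R.
  by rewrite (exprM r 2 2) -r2 sqr_sqrtr // ltW.
have rK : 4 * a / c <= r.
  rewrite -(@ler_pXn2r _ 4) // ?nnegrE; last exact: ltW.
    by rewrite -r4; apply: le_trans Kn; rewrite lerDl.
  by rewrite divr_ge0 ?mulr_ge0 // ltW.
rewrite r2 r4 lnXn // -mulr_natl.
have lr := ltW (ln_sublinear r0).
have : 4 * a <= r * c by rewrite -ler_pdivrMr.
have : a * ln r <= a * r by rewrite ler_wpM2l.
nra.
Qed.

(** Leaves the scale of sqrt n-th roots, on which the moments are computed.  The
hypothesis on [ln n], supplied by [ln_le_sqrt] for large n, says that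
n^a <= (1 + c)^(sqrt n). *)
Lemma powR_le_of_root {R : realType} (w a c : R) n : 0 <= w -> 0 < c ->
  (0 < n)%N -> a * ln n%:R <= Num.sqrt n%:R * ln (1 + c) ->
  1 + c < w `^ (Num.sqrt n%:R)^-1 -> n%:R `^ a <= w.
Proof.
move=> w0 c0 n0 le_a lt_w.
have s0 : 0 < Num.sqrt n%:R :> R by rewrite sqrtr_gt0 ltr0n.
have w_gt0 : 0 < w.
  rewrite lt_neqAle w0 andbT eq_sym; apply/eqP => we; move: lt_w.
  rewrite we powR0 ?invr_eq0 ?gt_eqF // => ?; lra.
rewrite /powR pnatr_eq0 gtn_eqF // -[leRHS](lnK (x := w)) ?posrE // ler_expR.
apply: le_trans le_a _.
have : ln (1 + c) < ln (w `^ (Num.sqrt n%:R)^-1).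
  by rewrite ltr_ln // posrE ?powR_gt0 //; lra.
rewrite ln_powR => /ltW; rewrite -(ler_pM2l s0) mulrA divff ?mul1r //.
by rewrite gt_eqF.
Qed.

Lemma not_summable {R : realType} (u : nat -> R) : (forall n, 0 <= u n) ->
  (forall N, exists2 n, (N <= n)%N & 1 <= u n) ->
  ~ (\sum_(0 <= n <oo) (u n)%:E < +oo)%E.
Proof.
move=> u0 io /(nnseries_is_cvg u0) /cvg_series_cvg_0.
move=> /cvgrPdist_lt /(_ 1 ltr01) [N _ uN].
have [n Nn] := io N; have := uN n Nn.
by rewrite /= sub0r normrN ger0_norm // => /lt_le_trans h /h; rewrite ltxx.
Qed.

(** * Expectations of products of independent variables *)

Section ProductRule.
Context {d : measure_display} {T : measurableType d} {R : realType}.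
Variable P : probability T R.

Lemma integral_indic_comp (Z : T -> R) (B : set R) :
  measurable_fun setT Z -> measurable B ->
  (\int[P]_x (\1_B (Z x))%:E = P (Z @^-1` B))%E.
Proof.
move=> mZ mB; rewrite (_ : (fun x => _) = fun x => (\1_(Z @^-1` B) x)%:E).
  by rewrite integral_indic ?setIT // -[X in measurable X]setTI; exact: mZ.
by apply/funext => x; rewrite !indicE.
Qed.

(** The image under Z of the measure with density V coincides with c times the law of
Z on all Borel sets, so both integrate g alike.  This is the one-variable step of
the product formula. *)
Lemma integral_indep_ext (V : T -> R) (Z : T -> R) (c : R) (g : R -> R) :
  measurable_fun setT V -> (forall x, 0 <= V x) ->
  measurable_fun setT Z -> measurable_fun setT g -> (forall y, 0 <= g y) ->
  (forall B, measurable B ->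
     (\int[P]_x (V x * \1_B (Z x))%:E = c%:E * P (Z @^-1` B))%E) ->
  (\int[P]_x (V x * g (Z x))%:E = c%:E * \int[P]_x (g (Z x))%:E)%E.
Proof.
move=> mV V0 mZ mg g0 hB.
(* The identity extends linearly to simple functions, *)
have simple (h : {nnsfun R >-> R}) :
    (\int[P]_x (V x * h (Z x))%:E = c%:E * \int[P]_x (h (Z x))%:E)%E.
  have mI y : measurable_fun setT (fun x : T => \1_(h @^-1` [set y]) (Z x) : R).
    by apply: measurableT_comp => //; exact: measurable_indic.
  have yI0 y (x : T) : 0 <= y * \1_(h @^-1` [set y]) (Z x) :> R.
    by have := nnfun_muleindic_ge0 h y (Z x); rewrite -EFinM lee_fin.
  have -> : (\int[P]_x (V x * h (Z x))%:E = \int[P]_x (\sum_(y \in range h)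
      (V x * (y * \1_(h @^-1` [set y]) (Z x)))%:E)%R)%E.
    apply: eq_integral => x _; rewrite fimfunE EFinM -fsumEFin //.
    by rewrite ge0_mule_fsumr // => y; rewrite lee_fin.
  have -> : (\int[P]_x (h (Z x))%:E = \int[P]_x (\sum_(y \in range h)
      (y * \1_(h @^-1` [set y]) (Z x))%:E)%R)%E.
    by apply: eq_integral => x _; rewrite fimfunE -fsumEFin.
  rewrite !ge0_integral_fsum //=; last 4 first.
  - by move=> y; apply/measurable_EFinP; apply: measurable_funM.
  - by move=> y x _; rewrite lee_fin.
  - move=> y; apply/measurable_EFinP; apply: measurable_funM => //.
    exact: measurable_funM.
  - by move=> y x _; rewrite lee_fin mulr_ge0.
  rewrite ge0_mule_fsumr; last first.
    by move=> y; apply: integral_ge0 => x _; rewrite lee_fin.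
  apply: eq_fsbigr => y /[!inE] -[z _ <-].
  have mh : measurable (h @^-1` [set h z]) by exact: measurable_funPTI.
  rewrite [X in (_ * X)%E](_ : _ =
      ((h z)%:E * P (Z @^-1` (h @^-1` [set h z])))%E); last first.
    under eq_integral do rewrite EFinM.
    rewrite ge0_integralZl_EFin //=; last first.
      exact: (iffRL (measurable_EFinP _ _) (mI (h z))).
    by rewrite integral_indic_comp.
  rewrite muleCA -hB //.
  rewrite -ge0_integralZl_EFin //; last 2 first.
  - by move=> x _; rewrite lee_fin mulr_ge0.
  - by apply/measurable_EFinP; apply: measurable_funM.
  by apply: eq_integral => x _; rewrite -EFinM mulrCA.
(* and by monotone convergence to nonnegative measurable functions. *)
have mg' : measurable_fun setT (EFin \o g) by exact/measurable_EFinP.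
pose g_ n : {nnsfun R >-> R} := nnsfun_approx measurableT mg' n.
have g_cvg y : (g_ n y)%:E @[n --> \oo] --> (g y)%:E.
  by apply: (cvg_nnsfun_approx measurableT mg') => // x _; rewrite lee_fin /=.
have g_nd y : {homo (fun n => g_ n y) : a b / (a <= b)%N >-> a <= b}.
  by move=> a b ab; exact/lefP/nd_nnsfun_approx.
have lim1 := @cvg_monotone_convergence _ _ _ P _ measurableT
  (fun n x => (V x * g_ n (Z x))%:E).
have lim2 := @cvg_monotone_convergence _ _ _ P _ measurableT
  (fun n x => (g_ n (Z x))%:E).
have e1 : (\int[P]_x (V x * g_ n (Z x))%:E)%E @[n --> \oo] -->
          (\int[P]_x (V x * g (Z x))%:E)%E.
  have -> : (\int[P]_x (V x * g (Z x))%:E =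
             \int[P]_x limn (fun n => (V x * g_ n (Z x))%:E))%E.
    apply: eq_integral => x _; apply/esym/cvg_lim => //.
    under eq_fun do rewrite EFinM.
    by rewrite EFinM; apply: cvgeZl.
  apply: lim1.
  - move=> n; apply/measurable_EFinP; apply: measurable_funM => //.
    exact: measurableT_comp.
  - by move=> n x _; rewrite lee_fin mulr_ge0.
  - by move=> x _ a b ab; rewrite lee_fin ler_wpM2l // g_nd.
have e2 : (\int[P]_x (g_ n (Z x))%:E)%E @[n --> \oo] -->
          (\int[P]_x (g (Z x))%:E)%E.
  have -> : (\int[P]_x (g (Z x))%:E =
             \int[P]_x limn (fun n => (g_ n (Z x))%:E))%E.
    by apply: eq_integral => x _; apply/esym/cvg_lim.
  apply: lim2.
  - by move=> n; apply/measurable_EFinP; exact: measurableT_comp.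
  - by move=> n x _; rewrite lee_fin.
  - by move=> x _ a b ab; rewrite lee_fin g_nd.
have : (c%:E * \int[P]_x (g_ n (Z x))%:E)%E @[n --> \oo] -->
       (\int[P]_x (V x * g (Z x))%:E)%E.
  rewrite (_ : (fun n => _) = fun n => (\int[P]_x (V x * g_ n (Z x))%:E)%E) //.
  by apply/funext => n; rewrite (simple (g_ n)).
by move=> h; apply: cvg_unique h _ => //; exact: cvgeZl.
Qed.

Lemma measurable_prod_comp (X : nat -> {RV P >-> R}) (g : nat -> R -> R)
    (N : nat) (Q : pred 'I_N) :
  (forall k, measurable_fun setT (g k)) ->
  measurable_fun setT (fun x => \prod_(k < N | Q k) g k (X k x)).
Proof.
move=> mg; under eq_fun do rewrite big_mkcond /=.
apply: measurable_prod => k _; case: (Q k) => //.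
exact: measurableT_comp.
Qed.

Lemma integral_prod_indic (X : nat -> {RV P >-> R}) (B : nat -> set R) N :
  mutually_independent X -> (forall k, measurable (B k)) ->
  (\int[P]_x (\prod_(k < N) \1_(B k) (X k x))%:E =
   \prod_(k < N) \int[P]_x (\1_(B k) (X k x))%:E)%E.
Proof.
move=> indep mB.
have mXB k : measurable (X k @^-1` B k) by exact: measurable_funPTI.
pose J : {fset nat} := [fset k in iota 0 N]%fset.
have JP k : (k \in J) = (k < N)%N by rewrite !inE mem_iota.
have big_J (F : nat -> \bar R) : (\prod_(k <- J) F k = \prod_(k < N) F k)%E.
  rewrite -(big_mkord xpredT) /index_iota subn0.
  apply: perm_big; apply: uniq_perm; rewrite ?fset_uniq ?iota_uniq // => k.
  by rewrite JP mem_iota.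
have -> : (fun x => (\prod_(k < N) \1_(B k) (X k x))%:E : \bar R) =
    fun x => (\1_(\bigcap_(k in [set` J]) (X k @^-1` B k)) x)%:E.
  apply/funext => x; congr EFin; rewrite [RHS]indicE.
  case: (pselect ((\bigcap_(k in [set` J]) (X k @^-1` B k)) x)) => [h|h].
    rewrite mem_set // big1 // => k _.
    rewrite indicE mem_set //; apply: (h k) => /=; by rewrite JP.
  rewrite memNset //; apply/eqP/prodf_eq0.
  apply: contrapT => hn; apply: h => k /=; rewrite JP => kN.
  apply: contrapT => nB; apply: hn; exists (Ordinal kN) => //=.
  by rewrite indicE memNset.
have mJ : measurable (\bigcap_(k in [set` J]) (X k @^-1` B k)).
  by apply: bigcap_measurableType => k _.
rewrite (integral_indic P measurableT mJ) setIT.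
transitivity (\prod_(k <- J) P (X k @^-1` B k))%E; first exact: indep.
rewrite big_J; apply: eq_bigr => k _.
by rewrite integral_indic_comp.
Qed.

(** Induction on the number n of leading factors that are arbitrary, the others
being indicators.  To pass from n to n + 1, freeze all factors but the n-th: for
an indicator in position n the formula is the induction hypothesis, and
[integral_indep_ext] replaces this indicator by [g n].  Finite expectations keep
the constant [c] of that lemma real. *)
Lemma integral_prod_indep (X : nat -> {RV P >-> R}) (g : nat -> R -> R) N :
  mutually_independent X ->
  (forall k, measurable_fun setT (g k)) -> (forall k y, 0 <= g k y) ->
  (forall k, \int[P]_x (g k (X k x))%:E < +oo)%E ->
  (\int[P]_x (\prod_(k < N) g k (X k x))%:E =
   \prod_(k < N) \int[P]_x (g k (X k x))%:E)%E.
Proof.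
move=> indep.
suff aux n : forall g : nat -> R -> R,
    (forall k, measurable_fun setT (g k)) -> (forall k y, 0 <= g k y) ->
    (forall k, \int[P]_x (g k (X k x))%:E < +oo)%E ->
    (forall k, (n <= k < N)%N -> exists2 B, measurable B & g k = \1_B) ->
    (\int[P]_x (\prod_(k < N) g k (X k x))%:E =
     \prod_(k < N) \int[P]_x (g k (X k x))%:E)%E.
  move=> mg g0 goo; apply: (aux N) => // k /andP[Nk kN].
  by rewrite ltnNge Nk in kN.
elim: n => [|n IH] {}g mg g0 goo gB.
  pose B k := g k @^-1` [set 1].
  have gE k : (k < N)%N -> g k = \1_(B k).
    move=> kN; have [C mC gC] := gB _ kN.
    apply/funext => y; rewrite /B gC !indicE.
    case: (asboolP (C y)) => Cy.
      by rewrite mem_set // mem_set //= indicE mem_set.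
    rewrite memNset // memNset //= indicE memNset //.
    by move/eqP; rewrite eq_sym oner_eq0.
  have mB k : measurable (B k).
    by rewrite -[B k]setTI; exact: mg.
  transitivity (\int[P]_x (\prod_(k < N) \1_(B k) (X k x))%:E)%E.
    apply: eq_integral => x _; congr EFin.
    by apply: eq_bigr => k _; rewrite gE.
  rewrite integral_prod_indic //; apply: eq_bigr => k _.
  by rewrite -gE.
have [Nn|nN] := leqP N n.
  apply: IH => // k /andP[nk kN].
  by have := leq_trans (leq_ltn_trans nk kN) Nn; rewrite ltnn.
pose i0 := Ordinal nN.
pose V x := \prod_(k < N | k != i0) g k (X k x).
pose c := (\prod_(k < N | k != i0) fine (\int[P]_x (g k (X k x))%:E))%R.
have cE : c%:E = (\prod_(k < N | k != i0) \int[P]_x (g k (X k x))%:E)%E.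
  rewrite /c -prodEFin; apply: eq_bigr => k _; rewrite fineK // ge0_fin_numE //.
  by apply: integral_ge0 => x _; rewrite lee_fin.
transitivity (\int[P]_x (V x * g n (X n x))%:E)%E.
  by apply: eq_integral => x _; rewrite (bigD1 i0) //= mulrC.
rewrite (bigD1 i0) //= muleC -cE.
apply: integral_indep_ext => //.
- exact: (measurable_prod_comp X g N (fun k => k != i0) mg).
- by move=> x; apply: prodr_ge0.
move=> B mB.
pose g' k := if k == n then \1_B else g k.
transitivity (\int[P]_x (\prod_(k < N) g' k (X k x))%:E)%E.
  apply: eq_integral => x _; rewrite [in RHS](bigD1 i0) //= mulrC /g' eqxx.
  congr ((_ * _)%:E); apply: eq_bigr => k /negbTE ki0.
  by rewrite -val_eqE /= in ki0; rewrite ki0.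
rewrite IH.
- rewrite (bigD1 i0) //= muleC cE /g' eqxx; congr (_ * _)%E.
    apply: eq_bigr => k /negbTE ki0.
    by rewrite -val_eqE /= in ki0; rewrite ki0.
  by rewrite integral_indic_comp.
- by move=> k; rewrite /g'; case: ifP => // _; exact: measurable_indic.
- by move=> k y; rewrite /g'; case: ifP.
- move=> k; rewrite /g'; case: ifP => // _.
  rewrite integral_indic_comp //; apply: le_lt_trans (ltry 1).
  by apply: probability_le1; exact: measurable_funPTI.
- move=> k /andP[nk kN]; rewrite /g'; case: ifPn => [_|kn]; first by exists B.
  by apply: gB; rewrite kN andbT ltn_neqAle eq_sym kn.
Qed.

Lemma integral_prod_iid (X : nat -> {RV P >-> R}) (g : R -> R) N :
  iid X -> measurable_fun setT g -> (forall y, 0 <= g y) ->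
  (\int[P]_x (g (X 0%N x))%:E < +oo)%E ->
  (\int[P]_x (\prod_(k < N) g (X k x))%:E =
   (\int[P]_x (g (X 0%N x))%:E) ^+ N)%E.
Proof.
move=> [indep ident] mg g0 goo.
have mg' : measurable_fun setT (EFin \o g) by exact/measurable_EFinP.
have same k : (\int[P]_x (g (X k x))%:E = \int[P]_x (g (X 0%N x))%:E)%E.
  transitivity (\int[distribution P (X k)]_y (g y)%:E)%E.
    by rewrite ge0_integral_distribution // => y; rewrite lee_fin.
  transitivity (\int[distribution P (X 0%N)]_y (g y)%:E)%E.
    by apply: eq_measure_integral => A mA _; exact: ident.
  by rewrite ge0_integral_distribution // => y; rewrite lee_fin.
rewrite (integral_prod_indep X (fun=> g)) //; last by move=> k; rewrite same.
rewrite (eq_bigr (fun=> \int[P]_x (g (X 0%N x))%:E)%E) => [|k _]; last exact: same.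
by rewrite big_const card_ord; elim: N => [|n IH]; rewrite ?iterS ?IH ?expe0 ?expeS.
Qed.

End ProductRule.

(** * A second moment lower bound for tail probabilities *)

Section SecondMoment.
Context {d : measure_display} {T : measurableType d} {R : realType}.
Variable P : probability T R.

(** A Paley-Zygmund inequality: the mass eps of E W in excess of 1 + eps has to be
carried by the event W > 1 + eps, and a bounded second moment prevents it from
sitting on an event of small probability. *)
Lemma prob_gt_of_second_moment (W : T -> R) (eps K : R) :
  measurable_fun setT W -> (forall x, 0 <= W x) -> 0 < eps -> 0 < K ->
  ((1 + 2 * eps)%:E <= \int[P]_x (W x)%:E)%E ->
  (\int[P]_x (W x ^+ 2)%:E <= K%:E)%E ->
  ((eps ^+ 2 / K)%:E <= P [set x | (1 + eps < W x)%R])%E.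
Proof.
move=> mW W0 eps0 K0 lo hi; set A := [set x | _].
have mA : measurable A.
  rewrite -[A]setTI (_ : A = W @^-1` `]1 + eps, +oo[%classic); first exact: mW.
  by apply/seteqP; split => x; rewrite /A /= in_itv /= andbT.
have mA1 : measurable_fun setT (\1_A : T -> R) by exact: measurable_indic.
have mW2 : measurable_fun setT (fun x => W x ^+ 2) by exact: measurable_funX.
(* AM-GM: W <= a W^2 + 1 / (4 a) on A.  The weight a = eps / (2 K) makes the
   second moment contribute at most eps / 2. *)
have pt x : W x <= (1 + eps) + (eps / (2 * K) * W x ^+ 2 + K / (2 * eps) * \1_A x).
  have e1 : eps / (2 * K) * (K / (2 * eps)) = 4^-1.
    by field; rewrite !gt_eqF.
  have a0 : 0 < eps / (2 * K) by rewrite divr_gt0 // mulr_gt0.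
  have b0 : 0 < K / (2 * eps) by rewrite divr_gt0 // mulr_gt0.
  rewrite indicE; case: (asboolP (A x)) => Ax.
    rewrite mem_set //=; move: e1 a0 b0; set a := eps / _; set b := K / _.
    move=> e1 a0 b0.
    suff : W x <= a * W x ^+ 2 + b by lra.
    rewrite -(ler_pM2l a0).
    have := sqr_ge0 (a * W x - 2^-1); nra.
  rewrite memNset //= mulr0 addr0.
  have : W x <= 1 + eps by rewrite leNgt; exact/negP.
  by have := sqr_ge0 (W x); nra.
have : (\int[P]_x (W x)%:E <= \int[P]_x ((1 + eps) + (eps / (2 * K) * W x ^+ 2 + K / (2 * eps) * \1_A x))%:E)%E.
  apply: ge0_le_integral => //.
  - by move=> x _; rewrite lee_fin.
  - exact/measurable_EFinP.
  - apply/measurable_EFinP; apply: measurable_funD => //.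
    by apply: measurable_funD; apply: measurable_funM.
  - by move=> x _; rewrite lee_fin.
have a0 : 0 <= eps / (2 * K) by rewrite divr_ge0 // ?mulr_ge0 // ltW.
have b0 : 0 <= K / (2 * eps) by rewrite divr_ge0 // ?mulr_ge0 // ltW.
have mE (f : T -> R) : measurable_fun setT f ->
  measurable_fun setT (fun x => (f x)%:E) by move=> mf; exact/measurable_EFinP.
have mf1 := mE _ (measurable_funM (measurable_cst (eps / (2 * K))) mW2).
have mf2 := mE _ (measurable_funM (measurable_cst (K / (2 * eps))) mA1).
have f1_ge0 x : (0 <= (eps / (2 * K) * W x ^+ 2)%:E)%E.
  by rewrite lee_fin mulr_ge0 // sqr_ge0.
have f2_ge0 x : (0 <= (K / (2 * eps) * \1_A x)%:E)%E by rewrite lee_fin mulr_ge0.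
have scale (k : R) (f : T -> R) : 0 <= k -> measurable_fun setT f ->
    (forall x, 0 <= f x) ->
    (\int[P]_x (k * f x)%:E = k%:E * \int[P]_x (f x)%:E)%E.
  move=> k0 mf f0; under eq_integral do rewrite EFinM.
  by rewrite ge0_integralZl_EFin // => [x _|]; [rewrite lee_fin|exact: mE].
have -> : (\int[P]_x ((1 + eps) + (eps / (2 * K) * W x ^+ 2 +
      K / (2 * eps) * \1_A x))%:E = (1 + eps)%:E + ((eps / (2 * K))%:E *
      \int[P]_x (W x ^+ 2)%:E + (K / (2 * eps))%:E * P A))%E.
  transitivity (\int[P]_x ((1 + eps)%:E + ((eps / (2 * K) * W x ^+ 2)%:E +
      (K / (2 * eps) * \1_A x)%:E)))%E; first by [].
  rewrite ge0_integralD //; last 3 first.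
  - by move=> x _; rewrite lee_fin addr_ge0 // ltW.
  - by move=> x _; rewrite adde_ge0.
  - exact: emeasurable_funD.
  rewrite ge0_integralD // integral_cst //; congr (_ + (_ + _))%E.
  - by rewrite -[RHS]mule1; congr (_ * _)%E; exact: (probability_setT P).
  - by apply: scale => // x; exact: sqr_ge0.
  by rewrite scale // integral_indic // setIT.
move=> le1.
have PA : P A \is a fin_num by rewrite fin_num_measure.
rewrite -(fineK PA) lee_fin.
have {}le1 := le_trans lo le1.
have le2 : ((1 + 2 * eps)%:E <= (1 + eps)%:E + ((eps / (2 * K))%:E * K%:E + (K / (2 * eps))%:E * (fine (P A))%:E))%E.
  rewrite (fineK PA); apply: (le_trans le1); rewrite leeD2l // leeD2r //.
  by apply: lee_wpmul2l => //; rewrite lee_fin.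
move: le2; rewrite -!EFinM -!EFinD lee_fin.
move: (fine (P A)) => p.
have -> : eps / (2 * K) * K = eps / 2 by field; rewrite gt_eqF.
move=> le2; have le3 : eps / 2 <= K / (2 * eps) * p by lra.
rewrite ler_pdivrMr //.
have : eps / 2 * (2 * eps) <= K / (2 * eps) * p * (2 * eps).
  by apply: ler_wpM2r => //; lra.
have -> : K / (2 * eps) * p * (2 * eps) = K * p by field; rewrite gt_eqF.
by nra.
Qed.

Lemma lim_sup_set_ge (E : nat -> set T) (delta : R) (N : nat) :
  (forall n, measurable (E n)) ->
  (forall n, (N <= n)%N -> (delta%:E <= P (E n))%E) ->
  (delta%:E <= P (lim_sup_set E))%E.
Proof.
move=> mE PE.
have mU n : measurable (\bigcup_(j >= n) E j) by exact: bigcup_measurable.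
have cv := lim_sup_set_cvg P E mE
  (le_lt_trans (probability_le1 P (mU 0%N)) (ltry 1)).
rewrite -(cvg_lim _ cv) //; apply: lime_ge; first by apply/cvg_ex; eexists; exact: cv.
exists N => // n Nn /=; apply: (le_trans (PE n Nn)).
by apply: le_measure; rewrite ?inE // => x Ex; exists n => /=.
Qed.

End SecondMoment.

(** * Exponential moments of a centred variable bounded above *)

Section ExpMoments.
Context {d : measure_display} {T : measurableType d} {R : realType}.
Variable P : probability T R.

Lemma integrable_affine (Y Z : T -> R) (t a : R) :
  P.-integrable setT (EFin \o Y) -> P.-integrable setT (EFin \o Z) ->
  P.-integrable setT (fun x => (1 + t * Y x + a * Z x)%:E).
Proof.
move=> iY iZ.
have i1 : P.-integrable setT (EFin \o cst (1 : R)).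
  by apply: finite_measure_integrable_cst.
apply: (@eq_integrable _ _ _ P setT measurableT
  (fun x => (1%:E + t%:E * (Y x)%:E) + a%:E * (Z x)%:E)%E) => //.
apply: integrableD => //; last exact: integrableZl.
by apply: integrableD => //; exact: integrableZl.
Qed.

Lemma integral_affine (Y Z : T -> R) (t a z : R) :
  P.-integrable setT (EFin \o Y) -> P.-integrable setT (EFin \o Z) ->
  (\int[P]_x (Y x)%:E = 0)%E -> (\int[P]_x (Z x)%:E = z%:E)%E ->
  (\int[P]_x (1 + t * Y x + a * Z x)%:E = (1 + a * z)%:E)%E.
Proof.
move=> iY iZ EY EZ.
have i1 : P.-integrable setT (EFin \o cst (1 : R)).
  by apply: finite_measure_integrable_cst.
transitivity (\int[P]_x ((1%:E + t%:E * (Y x)%:E) + a%:E * (Z x)%:E))%E.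
  by [].
rewrite integralD //; last 2 first.
- by apply: integrableD => //; exact: integrableZl.
- exact: integrableZl.
rewrite integralD //; last exact: integrableZl.
rewrite (integralZl measurableT iY) (integralZl measurableT iZ) EY EZ mule0 adde0.
rewrite integral_cst // EFinD EFinM; congr (_ + _)%E.
by rewrite mul1e; exact: (probability_setT P).
Qed.

Lemma integrable_of_square (Y : T -> R) (s : R) : measurable_fun setT Y ->
  (\int[P]_x (Y x ^+ 2)%:E = s%:E)%E ->
  P.-integrable setT (EFin \o (fun x => Y x ^+ 2)) /\
  P.-integrable setT (EFin \o Y).
Proof.
move=> mY EY2.
have mY2 : measurable_fun setT (fun x => Y x ^+ 2) by exact: measurable_funX.
have iY2 : P.-integrable setT (EFin \o (fun x => Y x ^+ 2)).
  apply/integrableP; split; first exact/measurable_EFinP.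
  rewrite (_ : (fun x => _) = fun x => (Y x ^+ 2)%:E) ?EY2 ?ltry //.
  by apply/funext => x; rewrite /= ger0_norm // sqr_ge0.
split => //.
(* |Y| <= 1 + Y^2. *)
have i := integrable_affine _ _ 0 1 iY2 iY2.
apply: le_integrable i => //; first exact/measurable_EFinP.
move=> x _ /=; rewrite lee_fin mul0r addr0 mul1r.
rewrite [leRHS]ger0_norm ?addr_ge0 ?sqr_ge0 //.
rewrite -(real_normK (num_real (Y x))); have := normr_ge0 (Y x).
by move: `|Y x| => u u0; have := sqr_ge0 (u - 1); nra.
Qed.

(** The bound on Y from above is what makes the quadratic majorant of the exponential
applicable; Y may be unbounded below. *)
Lemma expR_moment_le (Y : T -> R) (s B t : R) : measurable_fun setT Y ->
  (\int[P]_x (Y x)%:E = 0)%E -> (\int[P]_x (Y x ^+ 2)%:E = s%:E)%E ->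
  {ae P, forall x, Y x <= B} -> 0 <= t -> t * B <= 2^-1 ->
  (\int[P]_x (expR (t * Y x))%:E <= (1 + 2 * t ^+ 2 * s)%:E)%E.
Proof.
move=> mY EY EY2 YB t0 tB.
have [iY2 iY] := integrable_of_square _ _ mY EY2.
rewrite -(integral_affine _ _ t (2 * t ^+ 2) _ iY iY2 EY EY2).
apply: ae_ge0_le_integral => //.
- apply/measurable_EFinP; apply: measurableT_comp => //.
  exact: measurable_funM.
- move=> x _; rewrite lee_fin.
  by have := sqr_ge0 (1 + 2 * (t * Y x)); nra.
- exact: (measurable_int _ (integrable_affine _ _ t (2 * t ^+ 2) iY iY2)).
apply: filterS YB => x Yx _; rewrite lee_fin.
have := expR_le_quad (t * Y x); rewrite exprMn mulrA; apply.
by apply: le_trans tB; exact: ler_wpM2l.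
Qed.

(** This is where nondegeneracy enters: if the positive part vanished almost surely,
then Y <= 0 with mean 0 would force Y = 0, against E Y^2 = s > 0. *)
Lemma pos_part_square_gt0 (Y : T -> R) (s : R) : measurable_fun setT Y ->
  (\int[P]_x (Y x)%:E = 0)%E -> (\int[P]_x (Y x ^+ 2)%:E = s%:E)%E -> 0 < s ->
  exists q, [/\ 0 < q,
   P.-integrable setT (EFin \o (fun x => Num.max (Y x) 0 ^+ 2)) &
   (\int[P]_x (Num.max (Y x) 0 ^+ 2)%:E = q%:E)%E].
Proof.
move=> mY EY EY2 s0.
have [iY2 iY] := integrable_of_square _ _ mY EY2.
have mZ : measurable_fun setT (fun x => Num.max (Y x) 0 ^+ 2).
  by apply: measurable_funX; apply: measurable_maxr.
have iZ : P.-integrable setT (EFin \o (fun x => Num.max (Y x) 0 ^+ 2)).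
  apply: le_integrable iY2 => //; first exact/measurable_EFinP.
  move=> x _ /=; rewrite lee_fin !ger0_norm ?sqr_ge0 //.
  by have [Y0|Y0] := leP (Y x) 0; rewrite ?expr0n ?sqr_ge0.
have fZ := integrable_fin_num measurableT iZ.
have Z0 : (0 <= \int[P]_x (Num.max (Y x) 0 ^+ 2)%:E)%E.
  by apply: integral_ge0 => x _; rewrite lee_fin sqr_ge0.
exists (fine (\int[P]_x (Num.max (Y x) 0 ^+ 2)%:E)); split => //; last first.
  by rewrite fineK.
rewrite lt_neqAle fine_ge0 // andbT eq_sym; apply/eqP => Zeq0.
have /ae_eq_integral_abs : (\int[P]_x `|(Num.max (Y x) 0 ^+ 2)%:E| = 0)%E.
  under eq_integral do rewrite gee0_abs ?lee_fin ?sqr_ge0 //.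
  by rewrite -(fineK fZ) Zeq0.
move=> /(_ measurableT (iffRL (measurable_EFinP _ _) mZ)) aeZ.
have Yle0 : {ae P, forall x, Y x <= 0}.
  apply: filterS aeZ => x /(_ Logic.I) /= -[] /eqP.
  by rewrite sqrf_eq0; have [//|Y0] := leP (Y x) 0; rewrite gt_eqF.
have /ae_eq_integral_abs : (\int[P]_x `|(Y x)%:E| = 0)%E.
  transitivity (\int[P]_x (- (Y x)%:E))%E.
    apply: ae_eq_integral => //.
    - apply: measurableT_comp => //; exact/measurable_EFinP.
    - apply: measurableT_comp => //; exact/measurable_EFinP.
    by apply: filterS Yle0 => x Yx _; rewrite lee0_abs ?lee_fin.
  by rewrite integralN ?EY ?oppe0 // integrable_add_def.
move=> /(_ measurableT (iffRL (measurable_EFinP _ _) mY)) aeY.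
have : (\int[P]_x (Y x ^+ 2)%:E = 0)%E.
  rewrite (ae_eq_integral (cst 0%E)) ?integral0 //.
  - by apply/measurable_EFinP; exact: measurable_funX.
  - by apply: filterS aeY => x /(_ Logic.I) [->] _; rewrite expr0n.
by rewrite EY2 => -[] /eqP; rewrite gt_eqF.
Qed.

(** Only the positive part of Y enters the quadratic term, because a lower bound of
the form 1 + u + c u^2 with c > 0 fails for large negative u. *)
Lemma expR_moment_ge (Y : T -> R) (s q B t : R) : measurable_fun setT Y ->
  (\int[P]_x (Y x)%:E = 0)%E -> (\int[P]_x (Y x ^+ 2)%:E = s%:E)%E ->
  P.-integrable setT (EFin \o (fun x => Num.max (Y x) 0 ^+ 2)) ->
  (\int[P]_x (Num.max (Y x) 0 ^+ 2)%:E = q%:E)%E ->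
  {ae P, forall x, Y x <= B} -> 0 <= t -> t * B <= 2^-1 ->
  ((1 + t ^+ 2 / 4 * q)%:E <= \int[P]_x (expR (t * Y x))%:E)%E.
Proof.
move=> mY EY EY2 iZ EZ YB t0 tB.
have [iY2 iY] := integrable_of_square _ _ mY EY2.
rewrite -(integral_affine _ _ t (t ^+ 2 / 4) _ iY iZ EY EZ).
have le_oo := expR_moment_le _ _ _ _ mY EY EY2 YB t0 tB.
have mE : measurable_fun setT (fun x => expR (t * Y x)).
  by apply: measurableT_comp => //; exact: measurable_funM.
apply: le_integral => //; first exact: integrable_affine.
  apply/integrableP; split; first exact/measurable_EFinP.
  under eq_integral do rewrite gee0_abs ?lee_fin ?expR_ge0 //.
  by apply: le_lt_trans le_oo (ltry _).
move=> x _; rewrite lee_fin.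
have := expR_ge_quad (t * Y x).
have -> : Num.max (t * Y x) 0 = t * Num.max (Y x) 0.
  by rewrite maxr_pMr // mulr0.
by rewrite exprMn mulrAC.
Qed.

End ExpMoments.

(** * Fluctuations of the weights *)

Section WeightFluctuation.
Context {d : measure_display} {T : measurableType d} {R : realType}.
Variable P : probability T R.

Lemma measurable_prod_powR_gt (X : nat -> {RV P >-> R}) (c p : R) n :
  measurable [set x | c < \prod_(k < n) X k x `^ p].
Proof.
pose W x := \prod_(k < n) X k x `^ p.
have mW : measurable_fun setT W.
  apply: (measurable_prod_comp P X (fun _ y => y `^ p) n xpredT) => _.
  exact: measurable_powR.
rewrite -[X in measurable X]setTI (_ : [set x | _] = W @^-1` `]c, +oo[%classic).
  exact: mW.
by apply/seteqP; split => x; rewrite /= in_itv /= andbT.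
Qed.

(** The event says S_n > sqrt n ln (1 + eps): a fluctuation of the order predicted by
the central limit theorem, with probability at least [delta] for every large n.
With t = 1/sqrt n both moments E W >= (1 + t^2 q / 4)^n >= 1 + q / 4 and
E W^2 <= (1 + 8 t^2 s)^n <= exp (8 s) are controlled uniformly in n. *)
Lemma prob_root_weight_gt (X : nat -> {RV P >-> R}) (s M : R) : iid X ->
  {ae P, forall x, 0 < X 0%N x} -> {ae P, forall x, X 0%N x <= M} ->
  (\int[P]_x (ln (X 0%N x))%:E = 0)%E ->
  (\int[P]_x (ln (X 0%N x) ^+ 2)%:E = s%:E)%E -> 0 < s ->
  exists (eps delta : R) (N : nat), [/\ 0 < eps, 0 < delta & forall n, (N <= n)%N ->
    (delta%:E <= P [set x |
      (1 + eps < \prod_(k < n) X k x `^ (Num.sqrt n%:R)^-1)%R])%E].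
Proof.
move=> iidX X0 XM EY EY2 s0.
pose Y x := ln (X 0%N x).
have mY : measurable_fun setT Y.
  by apply: measurableT_comp => //; exact: measurable_ln.
have [q [q0 iZ EZ]] := pos_part_square_gt0 P Y s mY EY EY2 s0.
pose B : R := Num.max M 1.
have B0 : 0 < B by rewrite lt_max ltr01 orbT.
have YB : {ae P, forall x, Y x <= B}.
  apply: filterS2 X0 XM => x x0 xM; apply: le_trans (ltW (ln_sublinear x0)) _.
  by apply: le_trans xM _; rewrite le_max lexx.
have mom t : (\int[P]_x (X 0%N x `^ t)%:E = \int[P]_x (expR (t * Y x))%:E)%E.
  apply: ae_eq_integral => //.
  - apply/measurable_EFinP; apply: (measurableT_comp (measurable_powR t)) => //.
  - apply/measurable_EFinP; apply: measurableT_comp => //.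
    exact: measurable_funM.
  by apply: filterS X0 => x x0 _; rewrite /powR gt_eqF.
pose K := expR (8 * s).
exists (q / 8), ((q / 8) ^+ 2 / K), (Num.bound ((4 * B) ^+ 2)).
split; [lra| by rewrite divr_gt0 ?expR_gt0 // exprn_gt0 //; lra|].
move=> n Nn.
have Bn : (4 * B) ^+ 2 < n%:R.
  apply: (lt_le_trans (archi_boundP (sqr_ge0 (4 * B)))); by rewrite ler_nat.
have n0 : 0 < n%:R :> R by apply: le_lt_trans Bn; exact: sqr_ge0.
pose t : R := (Num.sqrt n%:R)^-1; rewrite -/t.
have r0 : 0 < Num.sqrt n%:R :> R by rewrite sqrtr_gt0.
have t0 : 0 < t by rewrite invr_gt0.
have t2 : t ^+ 2 = n%:R^-1 by rewrite exprVn sqr_sqrtr // ltW.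
(* sqrt n >= 4 B puts both exponents t and 2 t in the admissible range. *)
have tB : 2 * t * B <= 2^-1.
  have : 4 * B <= Num.sqrt n%:R.
    rewrite -(@ler_pXn2r _ 2) // ?nnegrE ?mulr_ge0 // ?(ltW B0) ?(ltW r0) //.
    by rewrite sqr_sqrtr ?(ltW Bn) ?(ltW n0).
  rewrite -(ler_pM2l t0) /t mulVf ?gt_eqF // -/t => h; lra.
have tB0 : 0 < t * B by exact: mulr_gt0.
have tB1 : t * B <= 2^-1 by lra.
have up t' : 0 <= t' -> t' * B <= 2^-1 ->
    (\int[P]_x (X 0%N x `^ t')%:E <= (1 + 2 * t' ^+ 2 * s)%:E)%E.
  by move=> ? ?; rewrite mom; exact: (expR_moment_le P Y s B).
have prodE t' : 0 <= t' -> t' * B <= 2^-1 ->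
    (\int[P]_x (\prod_(k < n) X k x `^ t')%:E =
     (\int[P]_x (X 0%N x `^ t')%:E) ^+ n)%E.
  move=> t'0 t'B; apply: (integral_prod_iid P X (fun y => y `^ t')) => //.
  - by move=> y; exact: powR_ge0.
  - exact: le_lt_trans (up _ t'0 t'B) (ltry _).
have fin t' : 0 <= t' -> t' * B <= 2^-1 ->
    (\int[P]_x (X 0%N x `^ t')%:E)%E \is a fin_num.
  move=> t'0 t'B; rewrite ge0_fin_numE.
    exact: le_lt_trans (up _ t'0 t'B) (ltry _).
  by apply: integral_ge0 => x _; rewrite lee_fin powR_ge0.
apply: prob_gt_of_second_moment.
- apply: (measurable_prod_comp P X (fun _ y => y `^ t) n xpredT) => _.
  exact: measurable_powR.
- by move=> x; apply: prodr_ge0 => k _; exact: powR_ge0.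
- lra.
- exact: expR_gt0.
- rewrite (prodE _ (ltW t0) tB1).
  have := expR_moment_ge P Y s q B t mY EY EY2 iZ EZ YB (ltW t0) tB1.
  rewrite -mom -(fineK (fin t (ltW t0) tB1)) -EFin_expe !lee_fin.
  set m := fine _ => hm.
  have x0 : 0 <= t ^+ 2 / 4 * q by rewrite mulr_ge0 ?divr_ge0 ?sqr_ge0 // ltW.
  apply: le_trans (_ : (1 + t ^+ 2 / 4 * q) ^+ n <= _); last first.
    by rewrite lerXn2r // nnegrE ?addr_ge0 // (le_trans _ hm) // addr_ge0.
  apply: le_trans (bernoulli_ineq _ n x0); rewrite t2 -mulr_natl.
  by rewrite lerD2l le_eqVlt; apply/orP; left; apply/eqP; field; rewrite gt_eqF.
have t20 : 0 <= 2 * t by rewrite mulr_ge0 // ltW.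
have -> : (\int[P]_x ((\prod_(k < n) X k x `^ t) ^+ 2)%:E =
           \int[P]_x (\prod_(k < n) X k x `^ (2 * t))%:E)%E.
  apply: eq_integral => x _; congr EFin; rewrite -prodrXl.
  by apply: eq_bigr => k _; rewrite mulrC powRrM powR_mulrn // powR_ge0.
rewrite prodE //; have := up _ t20 tB.
rewrite -(fineK (fin _ t20 tB)) -EFin_expe !lee_fin.
set m := fine _ => hm.
have m0 : 0 <= m.
  by apply: fine_ge0; apply: integral_ge0 => x _; rewrite lee_fin powR_ge0.
have -> : K = expR (8 * s / n%:R) ^+ n.
  by rewrite -expRM_natl; congr expR; field; rewrite gt_eqF.
rewrite lerXn2r // ?nnegrE ?expR_ge0 //.
apply: (le_trans hm); apply: le_trans (expR_ge1Dx _).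
rewrite lerD2l exprMn t2 le_eqVlt; apply/orP; left; apply/eqP; field.
by rewrite gt_eqF.
Qed.

Lemma powR_weight (X : nat -> {RV P >-> R}) (p : R) n (x : T) :
  (forall k, 0 <= X k x) ->
  0 <= weight X n x /\ weight X n x `^ p = \prod_(k < n) X k x `^ p.
Proof.
move=> X0; rewrite /weight; elim: n => [|n [IH0 IH]].
  by rewrite !big_ord0 powR1.
by rewrite !big_ord_recr /= powRM // IH; split => //; exact: mulr_ge0.
Qed.

End WeightFluctuation.

(** * Logarithmic moments *)

Lemma measurable_lne {R : realType} : measurable_fun setT (fun r : R => lne r%:E).
Proof.
rewrite /lne; apply: measurable_fun_ifT.
- by apply: measurable_fun_ler.
- exact: measurable_cst.
- by apply/measurable_EFinP; exact: measurable_ln.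
Qed.

Section LogMoments.
Context {d : measure_display} {T : measurableType d} {R : realType}.
Variables (P : probability T R) (Z : {RV P >-> R}).
Hypothesis Z_ge0 : {ae P, forall x, 0 <= Z x}.

Let measurable_lne_sqr :
  measurable_fun setT (fun x => (lne ((Z x) ^+ 2)%:E ^+ 2)%E).
Proof.
have mL : measurable_fun setT (fun x => lne ((Z x) ^+ 2)%:E).
  by apply: (measurableT_comp measurable_lne); exact: measurable_funX.
by under eq_fun do rewrite expe2; exact: emeasurable_funM.
Qed.

(** Since ln 0 = -oo, the square of the logarithm is +oo where Z = 0, and
a function with finite integral is finite almost everywhere. *)
Lemma ae_gt0_of_log_square (s : R) :
  (\int[P]_x (lne ((Z x) ^+ 2)%:E) ^+ 2 = s%:E)%E -> {ae P, forall x, 0 < Z x}.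
Proof.
move=> EZ.
have iL : P.-integrable setT (fun x => (lne ((Z x) ^+ 2)%:E ^+ 2)%E).
  apply/integrableP; split => //.
  under eq_integral do rewrite gee0_abs ?sqre_ge0 //.
  by rewrite EZ ltry.
apply: filterS2 Z_ge0 (integrable_ae measurableT iL) => x Zx /(_ Logic.I).
rewrite lt_neqAle Zx andbT eq_sym; apply: contraTN => /eqP ->.
by rewrite expr0n /= lexx.
Qed.

Lemma integral_ln_of_lne : {ae P, forall x, 0 < Z x} ->
  (\int[P]_x (ln (Z x))%:E = \int[P]_x lne (Z x)%:E)%E.
Proof.
move=> Z0; apply: ae_eq_integral => //.
- by apply/measurable_EFinP; apply: measurableT_comp => //; exact: measurable_ln.
- exact: (measurableT_comp measurable_lne).
by apply: filterS Z0 => x Zx _; rewrite lne_EFin.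
Qed.

Lemma integral_ln_square (s : R) : {ae P, forall x, 0 < Z x} ->
  (\int[P]_x (lne ((Z x) ^+ 2)%:E) ^+ 2 = s%:E)%E ->
  (\int[P]_x (ln (Z x) ^+ 2)%:E = (s / 4)%:E)%E.
Proof.
move=> Z0 EZ.
have mln : measurable_fun setT (fun x => ln (Z x)).
  by apply: measurableT_comp => //; exact: measurable_ln.
have mln2 : measurable_fun setT (fun x => (ln (Z x) ^+ 2)%:E).
  by apply/measurable_EFinP; exact: measurable_funX.
transitivity (\int[P]_x ((4^-1)%:E * (lne ((Z x) ^+ 2)%:E ^+ 2)))%E.
  apply: ae_eq_integral => //; first exact: emeasurable_funM.
  apply: filterS Z0 => x Zx _; rewrite lne_EFin ?exprn_gt0 // lnXn //.
  by rewrite -EFin_expe -EFinM; congr EFin; rewrite mulr2n; field.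
rewrite ge0_integralZl_EFin // ?EZ.
  by rewrite -EFinM mulrC.
by move=> x _; exact: sqre_ge0.
Qed.

End LogMoments.

(** * Polynomially decaying coefficients *)

Theorem corollary5p9 (d : measure_display) (T : measurableType d)
    (R : realType) (P : probability T R) (X : nat -> {RV P >-> R}) (sigma : R)
    (X_ge0 : forall n, {ae P, forall omega, 0 <= X n omega})
    (X_bounded : forall n, exists M : R,
       {ae P, forall omega, `|X n omega| <= M})
    (X_iid : iid X)
    (E_lnX : (\int[P]_omega lne (X 0%N omega)%:E = 0)%E)
    (sigma2_gt0 : 0 < sigma ^+ 2)
    (E_lnX2 : (\int[P]_omega (lne ((X 0%N omega) ^+ 2)%:E) ^+ 2
               = (sigma ^+ 2)%:E)%E)
    (alpha : R) (alpha_gt0 : 0 < alpha) :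
  ~ hardy_star X (zeta_series alpha).
Proof.
move=> star.
have X0_gt0 := ae_gt0_of_log_square P (X 0%N) (X_ge0 0%N) _ E_lnX2.
have [M X0_le] := X_bounded 0%N.
have {}X0_le : {ae P, forall x, X 0%N x <= M}.
  by apply: filterS X0_le => x; apply: le_trans; exact: ler_norm.
have [//||eps [delta [N [eps0 delta0 probE]]]] :=
    prob_root_weight_gt P X (sigma ^+ 2 / 4) M X_iid X0_gt0 X0_le _
      (integral_ln_square P (X 0%N) _ X0_gt0 E_lnX2) _.
- by rewrite integral_ln_of_lne.
- by rewrite divr_gt0.
(* The events w_n > (1 + eps)^(sqrt n), up to the null set where some X k < 0. *)
pose E n := [set x | 1 + eps < \prod_(k < n) X k x `^ (Num.sqrt n%:R)^-1].
have mE n : measurable (E n) by exact: measurable_prod_powR_gt.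
have limE := lim_sup_set_ge P E delta N mE probE.
have mlimE : measurable (lim_sup_set E).
  apply: bigcapT_measurable => n; exact: bigcup_measurable.
suff P0 : P (lim_sup_set E) = 0%E.
  by move: limE; rewrite P0 lee_fin leNgt delta0.
apply: (iffLR (@negligibleP _ _ _ P _ mlimE)).
have ln_eps : 0 < ln (1 + eps) by rewrite ln_gt0 // ltrDl.
have [N1 le_N1] := ln_le_sqrt alpha _ (ltW alpha_gt0) ln_eps.
suff : {ae P, forall x, ~ lim_sup_set E x}.
  by apply: negligibleS => x Ex /= /(_ Ex).
apply: filterS2 star (ae_foralln X_ge0) => x sum_x Xx io.
move: sum_x; rewrite /random_hardy /=; apply: not_summable.
  by move=> n; rewrite mulr_ge0 // sqr_ge0.
move=> n.
(* Beyond n, beyond the threshold N1, and nonzero since the coefficient of index 0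
   vanishes. *)
have [m /= nm Em] := io (maxn n (maxn N1 1)) Logic.I.
move: nm; rewrite !geq_max => /and3P[nm N1m m0].
exists m => //.
have [w0 wE] := powR_weight P X (Num.sqrt m%:R)^-1 m x Xx.
have lt_w : 1 + eps < weight X m x `^ (Num.sqrt m%:R)^-1 by rewrite wE.
have := powR_le_of_root _ _ _ _ w0 eps0 m0 (le_N1 m N1m) lt_w.
have p0 : 0 < m%:R `^ alpha :> R by rewrite powR_gt0 // ltr0n.
rewrite /zeta_series gtn_eqF // => le_w.
rewrite -exprMn exprn_ege1 //.
rewrite /ComplexField.Normc.normc /= expr0n /= addr0 sqrtr_sqr.
rewrite ger0_norm; last by rewrite invr_ge0 ltW.
by rewrite mulrC ler_pdivlMr // mul1r.
Qed.
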